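(* For every prime power $q$, $$\begin{aligned}A_q(16,4;4)\ge{}& q^{36} + q^{32} + q^{31} + 3q^{30} + 2q^{29} + 3q^{28} + q^{27} + q^{26} + 2q^{24} + q^{23} + 3q^{22} + 2q^{21}\\ &+ 4q^{20} + 2q^{19} + 4q^{18} + 2q^{17} + 4q^{16} + 2q^{15} + 4q^{14} + 2q^{13} + 5q^{12} + 2q^{11} + 4q^{10}\\ &+ 2q^9 + 4q^8 + 2q^7 + 4q^6 + 2q^5 + 3q^4 + q^3 + q^2 + 1.\end{aligned}$$
   Context: For a prime power $q$, the subspace distance between subspaces $U,U'$ of $\mathbb{F}_q^n$ is $d(U,U')=\dim(U+U')-\dim(U\cap U')$. $A_q(n,d;k)$ denotes the maximum cardinality of a set of $k$-dimensional subspaces of $\mathbb{F}_q^n$ any two distinct elements of which have subspace distance at least $d$ (a set with at most one element satisfies this vacuously). *)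

(* Defs.v *)
From HB Require Import structures.
From mathcomp Require Import all_boot all_order all_algebra all_field.

Set Implicit Arguments.
Unset Strict Implicit.
Unset Printing Implicit Defensive.

Definition prime_power (q : nat) : Prop :=
  exists p m : nat, [/\ prime p, 0 < m & q = p ^ m].

(* A vector space over a finite field has finitely many subspaces: {vspace vT}
   is by construction a subtype of a type of matrices over F. *)
Section FiniteVspace.
Import VectorInternalTheory.
Variables (F : finFieldType) (vT : vectType F).
HB.instance Definition _ := [Countable of {vspace vT} by <:].
HB.instance Definition _ := [Finite of {vspace vT} by <:].
End FiniteVspace.

(* The natural-number subtraction never truncates, since U :&: V is contained
   in U + V. *)
Definition subspace_dist (F : fieldType) (vT : vectType F)
    (U V : {vspace vT}) : nat :=
  \dim (U + V)%VS - \dim (U :&: V)%VS.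

Definition is_constant_dim_code (F : finFieldType) (n d k : nat)
    (C : {set {vspace 'rV[F]_n}}) : bool :=
  [forall U in C, \dim U == k] &&
  [forall U in C, forall V in C, (U != V) ==> (d <= subspace_dist U V)].

(* A_q(n, d; k), with F a field of q elements. *)
Definition max_code_size (F : finFieldType) (n d k : nat) : nat :=
  \max_(C : {set {vspace 'rV[F]_n}} | is_constant_dim_code d k C) #|C|.

(* Main.v *)
From HB Require Import structures.
Require Import Defs.
From mathcomp Require Import all_boot all_order all_algebra all_field zify ring.
Set Implicit Arguments.
Unset Strict Implicit.
Unset Printing Implicit Defensive.
Import GRing.Theory.

(** The space F^16 is split into four factors F^4.  A codeword is the row space of
    a 4 x 16 matrix (G_0, G_1, G_2, G_3) of one of two shapes.

    - For a factor i: zero blocks before i, the identity at i, and after i blocks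
      from a linear code of q^12 matrices of size 4 x 4 with rank distance 2.
    - For two factors i < j and two lines A, B of PG(3, q) from one class of a
      packing: zero blocks before i; (A ; 0) at i; between i and j, blocks
      (N ; 0) with N = (N_1 | N_2), where N_1 and N_2 come from a field of q^2
      matrices of size 2 x 2; (N C ; B) at j, with C a complement of B and N in
      that field; after j, blocks from the code of 4 x 4 matrices.

    The dimension of the intersection of two codewords is at most the sum over the
    four factors of the dimensions of the intersections of their graded pieces
    ([filtration_dim]).  The sum is at most 2 for codewords with different data
    i, j, A, B, because distinct lines meet in dimension at most 1, and in
    dimension 0 if they belong to one class ([graded_cap]).
    For equal data, the rank distances give the same bound ([dim_cap_same]).
    Hence any two codewords have subspace distance at least 4.  With q^2 + q + 1
    classes of q^2 + 1 lines the number of codewords is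
      q^36 + q^24 + q^12 + 1 + (q^2 + q + 1) (q^2 + 1)^2
        (q^26 + q^18 + q^14 + q^10 + q^6 + q^2),
    which is the polynomial of the theorem ([construction_weight]).

    Packings exist for all q ([exists_line_packing]).  For q > 2, let K be a field
    of q^2 matrices of size 2 x 2 and K' another one, both containing F.  One
    class is the regular spread of K; for each affine F-line a + b F of K, another
    class is obtained from the regular spread of a + b K' by reversing the regulus
    of a + b F.  Every matrix outside K lies in exactly one a + b (K' \ F), because
    every 2 x 2 matrix is uniquely of the form x + y k' with x, y in K, where k'
    generates K'.  For q = 2 an explicit packing is checked by computation. *)

(** * Irreducible quadratics and fields of 2 x 2 matrices *)

(** Applied to [x^2 - x] over a finite field, this gives an irreducible quadratic
    polynomial in every characteristic. *)
Lemma not_surj_of_collision (T : finType) (f : T -> T) (x y : T) :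
  x != y -> f x = f y -> exists w, forall z, f z != w.
Proof.
move=> neq_xy eq_f.
case: (pickP [pred w | [forall z, f z != w]]) => [w /forallP nw | allw].
  by exists w.
have sur w : exists z, f z == w.
  have /negbT := allw w; rewrite /= negb_forall => /existsP[z].
  by rewrite negbK; exists z.
pose g w := xchoose (sur w).
have gK : cancel g f by move=> w; apply/eqP/(xchooseP (sur w)).
have [h hK fK] : bijective g by apply: injF_bij; apply: can_inj gK.
have injf : injective f by move=> a b; rewrite -(fK a) -(fK b) !gK => ->.
by case/eqP: neq_xy; apply: injf.
Qed.

Section QuadraticField.
Local Open Scope ring_scope.
Variable F : fieldType.

Lemma row2P (p r : 'rV[F]_2) : p 0 0 = r 0 0 -> p 0 1 = r 0 1 -> p = r.
Proof.
move=> e0 e1; apply/rowP=> j; case: (unliftP 0 j) => [j'|] -> //.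
by rewrite ord1 (_ : lift 0 0 = 1) //; apply: val_inj.
Qed.

Lemma mx2P (A B : 'M[F]_2) :
  A 0 0 = B 0 0 -> A 0 1 = B 0 1 -> A 1 0 = B 1 0 -> A 1 1 = B 1 1 -> A = B.
Proof.
move=> e00 e01 e10 e11; apply/row_matrixP=> i; apply: row2P; rewrite !mxE;
case: (unliftP 0 i) => [i'|] -> //;
by rewrite ord1 (_ : lift 0 0 = 1) //; apply: val_inj.
Qed.

Variable v : F.

(** The matrix [p0 + p1 J_c], where [J_c] has rows (0, c) and (v / c, 1).  For
    [c != 0] one has [J_c ^ 2 = J_c + v], and all the [J_c] are conjugate.  When
    [X^2 - X - v] has no root, the matrices [quad_mx c p] form a quadratic
    extension field of F; the first row of [quad_mx 1 p] is [p]. *)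
Definition quad_mx (c : F) (p : 'rV[F]_2) : 'M[F]_2 :=
  \matrix_(i, j) if i == 0 then (if j == 0 then p 0 0 else c * p 0 1)
                 else (if j == 0 then v / c * p 0 1 else p 0 0 + p 0 1).

Fact quad_mx_linear c : linear (quad_mx c).
Proof. by move=> a p r; apply: mx2P; rewrite !mxE /=; ring. Qed.
HB.instance Definition _ c :=
  GRing.isLinear.Build F 'rV[F]_2 'M[F]_2 _ (quad_mx c) (quad_mx_linear c).

(** The norm form of F[J]; it is the determinant of [quad_mx c p]. *)
Definition qnorm (p : 'rV[F]_2) : F := p 0 0 ^+ 2 + p 0 0 * p 0 1 - v * p 0 1 ^+ 2.

(** Conjugation in F[J]: J is sent to 1 - J. *)
Definition qconj (p : 'rV[F]_2) : 'rV[F]_2 :=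
  \row_j if j == 0 then p 0 0 + p 0 1 else - p 0 1.

Lemma mulmx2E m n (A : 'M[F]_(m, 2)) (B : 'M[F]_(2, n)) i j :
  (A *m B) i j = A i 0 * B 0 j + A i 1 * B 1 j.
Proof.
rewrite mxE !big_ord_recl big_ord0 addr0.
by rewrite (_ : lift ord0 ord0 = 1) //; apply: val_inj.
Qed.

Lemma quad_mx_norm c p :
  c != 0 -> quad_mx c p *m quad_mx c (qconj p) = (qnorm p)%:M.
Proof.
by move=> c0; apply: mx2P; rewrite !(mulmx2E, mxE) /= /qnorm; field.
Qed.

Lemma quad_mxM c p r :
  c != 0 -> quad_mx c p *m quad_mx c r = quad_mx c (p *m quad_mx 1 r).
Proof. by move=> c0; apply: mx2P; rewrite !(mulmx2E, mxE) /= ?divr1; field. Qed.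

Lemma quad_mxC p r : quad_mx 1 p *m quad_mx 1 r = quad_mx 1 r *m quad_mx 1 p.
Proof. by apply: mx2P; rewrite !(mulmx2E, mxE) /= ?divr1; ring. Qed.

Lemma quad_mx_inj : injective (quad_mx 1).
Proof.
move=> p r /matrixP e; apply: row2P.
  by have := e 0 0; rewrite !mxE.
by have := e 0 1; rewrite !mxE /= !mul1r.
Qed.

Lemma quad_mx_const c a : quad_mx c (a *: delta_mx 0 0) = a%:M.
Proof. by apply: mx2P; rewrite !mxE /= ?mulr1 ?mulr0 ?addr0. Qed.

Hypothesis v_irr : forall x : F, x ^+ 2 - x != v.

Lemma qnorm_neq0 p : p != 0 -> qnorm p != 0.
Proof.
move=> p0; apply/eqP; rewrite /qnorm => n0.
have [p1|p1] := eqVneq (p 0 1) 0.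
  move: n0; rewrite p1 expr0n mulr0 /= mulr0 subr0 addr0 => /eqP.
  rewrite sqrf_eq0 => /eqP p00; case/eqP: p0.
  by apply: row2P; rewrite !mxE.
case/eqP: (v_irr (- p 0 0 / p 0 1)); apply/eqP; rewrite -subr_eq0; apply/eqP.
transitivity ((p 0 0 ^+ 2 + p 0 0 * p 0 1 - v * p 0 1 ^+ 2) / p 0 1 ^+ 2).
  by field.
by rewrite n0 mul0r.
Qed.

Lemma quad_mx_unit c p : c != 0 -> p != 0 -> quad_mx c p \in unitmx.
Proof.
move=> c0 /qnorm_neq0 n0.
apply: (proj1 (mulmx1_unit (B := (qnorm p)^-1 *: quad_mx c (qconj p)) _)).
by rewrite -scalemxAr quad_mx_norm // scale_scalar_mx mulVf.
Qed.

Lemma quad_mx_inv p :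
  exists r, invmx (quad_mx 1 p) = quad_mx 1 r.
Proof.
have [->|p0] := eqVneq p 0.
  by exists 0; rewrite linear0 invmx_out // inE unitmxE det0 unitr0.
exists ((qnorm p)^-1 *: qconj p).
have := quad_mx_norm p (oner_neq0 F).
move=> /(congr1 (mulmx (invmx (quad_mx 1 p)))).
rewrite mulKmx ?quad_mx_unit ?oner_neq0 // mul_mx_scalar linearZ /= => ->.
by rewrite scalerA mulVf ?scale1r ?qnorm_neq0.
Qed.

(** The field [K = F[J_1]] does not contain [J_c] when [c] is neither 0 nor 1,
    so that all 2 x 2 matrices decompose uniquely in [K + K J_c]. *)
Lemma quad_mx_direct c p r p' r' : c != 0 -> c != 1 ->
  quad_mx 1 p + quad_mx 1 r *m quad_mx c (delta_mx 0 1) =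
  quad_mx 1 p' + quad_mx 1 r' *m quad_mx c (delta_mx 0 1) -> p = p' /\ r = r'.
Proof.
move=> c0 c1 /eqP; rewrite -subr_eq0 opprD addrACA -mulmxBl -!linearB /=.
rewrite addr_eq0 => /eqP e.
have [/eqP|r0] := eqVneq (r - r') 0.
  rewrite subr_eq0 => /eqP er; move: e; rewrite er subrr linear0 mul0mx oppr0.
  by rewrite -(linear0 (quad_mx 1)) => /quad_mx_inj/eqP; rewrite subr_eq0 => /eqP.
have [s es] := quad_mx_inv (r - r').
move/(congr1 (mulmx (invmx (quad_mx 1 (r - r'))))) : e.
rewrite mulmxN mulKmx ?quad_mx_unit ?oner_neq0 // es quad_mxM ?oner_neq0 //.
move: (s *m _) => t /matrixP e; case/eqP: c1.
have e00 := e 0 0; have e01 := e 0 1; have e11 := e 1 1.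
move: e00 e01 e11; rewrite !mxE /= !mulr1 add0r mul1r oppr0 => -> -> .
by rewrite add0r => /oppr_inj.
Qed.
End QuadraticField.

(** * A packing of the lines of PG(3, q), for q > 2 *)

Section Packing.
Local Open Scope ring_scope.
Variable F : finFieldType.

(** A family of lines of PG(3, q), given by 2 x 4 generator matrices and sorted
    into classes indexed by [Cl]: lines of one class are pairwise disjoint, and
    lines of different classes are distinct.  With [q^2 + q + 1] classes of
    [q^2 + 1] lines this is a partition of the set of all lines into spreads. *)
Definition line_packing (Cl Ix : finType) (L : Cl -> Ix -> 'M[F]_(2, 4)) :=
  [/\ forall c i, row_free (L c i),
      forall c i i' (x y : 'rV_2), i != i' -> x *m L c i = y *m L c i' -> x = 0
    & forall c c' i i', c != c' -> ~~ (L c i <= L c' i')%MS].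

Lemma row_free_submx_sym m n (A B : 'M[F]_(m, n)) :
  row_free A -> row_free B -> (A <= B)%MS -> (B <= A)%MS.
Proof.
by move=> /eqP rA /eqP rB sAB; rewrite -(mxrank_leqif_sup sAB) rA rB.
Qed.

Lemma row_free_vec m n (A : 'M[F]_(m, n)) :
  (forall y : 'rV_m, y *m A = 0 -> y = 0) -> row_free A.
Proof.
move=> inj; rewrite -kermx_eq0; apply/eqP/row_matrixP=> j; rewrite row0.
by apply: inj; rewrite -row_mul mulmx_ker row0.
Qed.

Lemma submx_vec m n p (A : 'M[F]_(m, n)) (B : 'M[F]_(p, n)) (y : 'rV_m) :
  (A <= B)%MS -> exists y', y *m A = y' *m B.
Proof. by case/submxP=> D ->; exists (y *m D); rewrite mulmxA. Qed.

Definition row2 (a b : F) : 'rV[F]_2 := \row_j if j == 0 then a else b.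

(** Representatives of the points of the projective line over F. *)
Definition pt (o : option F) : 'rV[F]_2 :=
  if o is Some s then row2 s 1 else row2 1 0.

Lemma pt_neq0 o : pt o != 0.
Proof.
apply/eqP=> /rowP e; move: (e 0) (e 1); rewrite !mxE.
by case: o {e} => [s|]; rewrite !mxE /= => e0 e1; [move/eqP: e1|move/eqP: e0];
  rewrite oner_eq0.
Qed.

Lemma pt_indep o o' (a b : F) :
  o != o' -> a *: pt o = b *: pt o' -> a = 0 /\ b = 0.
Proof.
move=> neq_o /rowP e; move: (e 0) (e 1); clear e; rewrite !mxE.
case: o o' neq_o => [s|] [s'|] //= neq_o; rewrite !mxE /= ?mulr0 ?mulr1 => e0 e1.
- move: e0; rewrite e1 => /eqP; rewrite -subr_eq0 -mulrBr mulf_eq0 subr_eq0.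
  case/orP=> [/eqP-> // | /eqP es].
  by case/eqP: neq_o; rewrite es.
- by move: e0; rewrite e1 mul0r => <-.
- by rewrite e0 -e1 mul0r.
Qed.

(** Representatives of F^2 modulo the line spanned by [pt o]. *)
Definition off (o : option F) (t : F) : 'rV[F]_2 :=
  if o is Some _ then row2 t 0 else row2 0 t.

Lemma off_inj o t t' d : off o t - off o t' = d *: pt o -> t = t'.
Proof.
move=> /rowP e; move: (e 0) (e 1); clear e; rewrite !mxE.
case: o => [s|]; rewrite /= !mxE /= ?mulr0 ?mulr1.
  by rewrite subrr => + e; rewrite -e mul0r => /eqP; rewrite subr_eq0 => /eqP.
by move=> _ /eqP; rewrite subr_eq0 => /eqP.
Qed.

Variables (v c : F).
Hypothesis v_irr : forall x : F, x ^+ 2 - x != v.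
Hypotheses (c_neq0 : c != 0) (c_neq1 : c != 1).

Notation K := (quad_mx v 1).
Notation K' := (quad_mx v c).

(** The line of all [(y, y M)]. *)
Definition graph_line (M : 'M[F]_2) : 'M[F]_(2, 2 + 2) := row_mx 1%:M M.
(** The line of all [(0, y)]. *)
Definition infinity_line : 'M[F]_(2, 2 + 2) := row_mx 0 1%:M.
(** The line spanned by [(x, x a)] and [(0, x b)], where [a], [b] are elements of
    the field [K], given by their coordinates on [1] and [J_1].  When [x] varies, these [q + 1] lines are the transversals of
    the regulus formed by [infinity_line] and the graphs of [a + s b], [s] in F. *)
Definition transversal (x a b : 'rV[F]_2) : 'M[F]_(1 + 1, 2 + 2) :=
  col_mx (row_mx x (x *m K a)) (row_mx 0 (x *m K b)).

Lemma row22_inj (x y x' y' : 'rV[F]_2) :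
  row_mx x y = row_mx x' y' :> 'rV_4 -> x = x' /\ y = y'.
Proof. exact: (@eq_row_mx _ 1 2 2). Qed.

Lemma row22_mx_inj (A B A' B' : 'M[F]_2) :
  row_mx A B = row_mx A' B' :> 'M_(2, 4) -> A = A' /\ B = B'.
Proof. exact: (@eq_row_mx _ 2 2 2). Qed.

Lemma mul_graph_line (y : 'rV_2) M : y *m graph_line M = row_mx y (y *m M).
Proof. by rewrite mul_mx_row mulmx1. Qed.

Lemma mul_infinity_line (y : 'rV_2) : y *m infinity_line = row_mx 0 y.
Proof. by rewrite mul_mx_row mulmx0 mulmx1. Qed.

Lemma mul_transversal (y : 'rV_2) x a b :
  y *m transversal x a b =
  row_mx (y 0 0 *: x) (x *m K (y 0 0 *: a + y 0 1 *: b)).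
Proof.
transitivity (row_mx (lsubmx (y : 'rV_(1 + 1))) (rsubmx (y : 'rV_(1 + 1))) *m
  transversal x a b); first by rewrite hsubmxK.
rewrite mul_row_col.
rewrite [lsubmx _]mx11_scalar [rsubmx _]mx11_scalar !mul_scalar_mx.
rewrite !scale_row_mx add_row_mx scaler0 addr0.
rewrite [lsubmx _ 0 0]mxE [rsubmx _ 0 0]mxE.
rewrite (_ : lshift 1 0 = 0); last exact: val_inj.
rewrite (_ : rshift 1 0 = 1); last exact: val_inj.
by rewrite linearD !linearZ /= mulmxDr -!scalemxAr.
Qed.

Lemma K_unit p : p != 0 -> K p \in unitmx.
Proof. by apply: quad_mx_unit; rewrite ?oner_neq0. Qed.

Lemma mulK_eq0 (x p : 'rV_2) : x *m K p = 0 -> x != 0 -> p = 0.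
Proof.
move=> e; apply: contra_neq_eq => /K_unit u.
by rewrite -[x](mulmxK u) e mul0mx.
Qed.

Lemma mulK'_eq0 (x p : 'rV_2) : x *m K' p = 0 -> x != 0 -> p = 0.
Proof.
move=> e; apply: contra_neq_eq => /(quad_mx_unit v_irr c_neq0) u.
by rewrite -[x](mulmxK u) e mul0mx.
Qed.

(** The matrix [a + b k], where [a] and [b] are in [K] and [k] is in [K']. *)
Definition shifted (a b k : 'rV[F]_2) : 'M[F]_2 := K a + K b *m K' k.

(** The packing.  The class [None] is the regular spread formed by
    [infinity_line] and the graphs of the elements of [K].  The other classes
    correspond to the reguli of that spread that contain [infinity_line], that
    is, to the affine F-lines [a + b F] of [K]; here [b] is a representative
    [pt o] of a point of [P(K)] and [a] a representative [off o t] of [K / b F].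
    The class of [a + b F] consists of the graphs of the elements of
    [a + b (K' \ F)] and of the transversals of the regulus.  Within it, the
    index [Some (s, u)] stands for [k = s + u J_c] when [u != 0], while the
    indices [Some (s, 0)] and [None] stand for the transversals with
    [x = pt (Some s)] and [x = pt None]. *)
Definition packing_line (cl : option (option F * F)) (i : option (F * F)) :
    'M[F]_(2, 4) :=
  match cl, i with
  | None, None => infinity_line
  | None, Some (s, u) => graph_line (K (row2 s u))
  | Some (o, t), None => transversal (pt None) (off o t) (pt o)
  | Some (o, t), Some (s, u) =>
    if u == 0 then transversal (pt (Some s)) (off o t) (pt o)
    else graph_line (shifted (off o t) (pt o) (row2 s u))
  end.

(** The four kinds of lines of the packing. *)
Variant line_spec (cl : option (option F * F)) : option (F * F) -> 'M[F]_(2, 4) -> Type :=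
  | LineInf of cl = None : line_spec cl None infinity_line
  | LineField s u of cl = None :
      line_spec cl (Some (s, u)) (graph_line (K (row2 s u)))
  | LineTrans o t p of cl = Some (o, t) :
      line_spec cl (omap (fun s => (s, 0)) p)
                   (transversal (pt p) (off o t) (pt o))
  | LineGraph o t s u of cl = Some (o, t) & u != 0 :
      line_spec cl (Some (s, u))
                   (graph_line (shifted (off o t) (pt o) (row2 s u))).

Lemma packing_lineP cl i : line_spec cl i (packing_line cl i).
Proof.
case: cl i => [[o t]|] [[s u]|] /=; try by constructor.
  have [->|u0] := eqVneq u 0; last by constructor.
  exact: (@LineTrans (Some (o, t)) o t (Some s)).
exact: (@LineTrans (Some (o, t)) o t None).
Qed.

Lemma row2_inj s u s' u' : row2 s u = row2 s' u' -> s = s' /\ u = u'.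
Proof. by move=> /rowP e; move: (e 0) (e 1); rewrite !mxE. Qed.

(** The reason is that [k = s + u J_c] has no eigenvector when [u != 0]. *)
Lemma shifted_trans_disjoint (y y' : 'rV_2) o t s u p : u != 0 ->
  y *m transversal (pt p) (off o t) (pt o) =
    y' *m graph_line (shifted (off o t) (pt o) (row2 s u)) ->
  y = 0 /\ y' = 0.
Proof.
move=> u0; rewrite mul_graph_line mul_transversal => /row22_inj[<-].
rewrite linearD !linearZ /= !mulmxDr -!scalemxAl -!scalemxAr => /addrI.
rewrite mulmxA; have z0 : pt p *m K (pt o) != 0.
  apply/eqP=> /mulK_eq0/(_ (pt_neq0 p)); apply/eqP; exact: pt_neq0.
move: (_ *m K (pt o)) z0 => z z0 /eqP; rewrite -subr_eq0 => /eqP e.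
have {e}: z *m K' (row2 (y 0 1) 0 - y 0 0 *: row2 s u) = 0.
  rewrite linearB linearZ /= mulmxBr -scalemxAr -[X in _ = X]e.
  rewrite (_ : row2 _ _ = y 0 1 *: delta_mx 0 0).
    by rewrite quad_mx_const mul_mx_scalar.
  by apply: row2P; rewrite !mxE /= ?mulr1 ?mulr0.
move/mulK'_eq0/(_ z0)/rowP=> e; have := e 1; have := e 0; rewrite !mxE /= sub0r.
move=> e0 /eqP; rewrite oppr_eq0 mulf_eq0 (negPf u0) orbF => /eqP y0.
move: e0; rewrite y0 mul0r subr0 scale0r => y1; split=> //.
by apply: row2P; rewrite !mxE.
Qed.

Lemma packing_line_disjoint cl i i' (y y' : 'rV_2) : i != i' ->
  y *m packing_line cl i = y' *m packing_line cl i' -> y = 0.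
Proof.
case: (packing_lineP cl i) => [e|s u e|o t p e|o t s u e u0];
case: (packing_lineP cl i') => [e'|s' u' e'|o' t' p' e'|o' t' s' u' e' u0'];
  move: e'; rewrite e // {cl e}.
- by rewrite mul_infinity_line mul_graph_line => _ _ /row22_inj[<-]; rewrite mul0mx.
- by rewrite mul_infinity_line mul_graph_line => _ _ /row22_inj[].
- rewrite !mul_graph_line => _ neq /row22_inj[<-] /eqP.
  rewrite -subr_eq0 -mulmxBr -linearB => /eqP /mulK_eq0 e.
  apply: contra_neq_eq neq => /e /eqP; rewrite subr_eq0 => /eqP /row2_inj.
  by case=> -> ->.
- move=> [<- <-] neq; rewrite !mul_transversal => /row22_inj[].
  have {}neq : p != p' by apply: contra_neq neq => ->.
  move/(pt_indep neq)=> [y0 y0']; rewrite y0 y0' !scale0r !add0r !linearZ /=.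
  rewrite !scalemxAl => /eqP; rewrite -subr_eq0 -mulmxBl => /eqP e.
  have : y 0 1 *: pt p = y' 0 1 *: pt p'.
    apply/eqP; rewrite -subr_eq0; apply/negPn/negP=> z0.
    by case/eqP: (pt_neq0 o); apply: mulK_eq0 e z0.
  by move/(pt_indep neq)=> [y1 _]; apply: row2P; rewrite !mxE.
- by move=> [<- <-] _ /(shifted_trans_disjoint u0') [].
- by move=> [<- <-] _ /esym /(shifted_trans_disjoint u0) [].
- move=> [<- <-] neq; rewrite !mul_graph_line => /row22_inj[<-].
  rewrite !mulmxDr => /addrI /eqP; rewrite !mulmxA -subr_eq0 -mulmxBr -linearB.
  move=> /eqP /mulK'_eq0 e; apply: contra_neq_eq neq => y0.
  have /e/eqP : y *m K (pt o) != 0.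
    by apply/eqP=> /mulK_eq0/(_ y0); apply/eqP/pt_neq0.
  by rewrite subr_eq0 => /eqP /row2_inj [-> ->].
Qed.

Lemma packing_line_free cl i : row_free (packing_line cl i).
Proof.
apply: row_free_vec => y e.
have [i' neq] : exists i', i != i'.
  by case: i {e} => [p|]; [exists None | exists (Some (0, 0))].
by apply: (packing_line_disjoint (cl := cl) (y' := 0) neq); rewrite e mul0mx.
Qed.

Lemma graph_line_inj M M' : (graph_line M <= graph_line M')%MS -> M = M'.
Proof.
move=> s; apply/row_matrixP=> j; rewrite !rowE.
have [y'] := submx_vec (delta_mx 0 j) s; rewrite !mul_graph_line.
by case/row22_inj=> <-.
Qed.

Lemma graph_not_infinity M : ~~ (graph_line M <= infinity_line)%MS.
Proof.
apply/negP=> /(submx_vec (pt None))[y'].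
rewrite mul_graph_line mul_infinity_line => /row22_inj[/eqP].
by rewrite (negPf (pt_neq0 None)).
Qed.

Lemma trans_not_infinity p a b :
  ~~ (transversal (pt p) a b <= infinity_line)%MS.
Proof.
apply/negP=> /(submx_vec (pt None))[y'].
rewrite mul_transversal mul_infinity_line => /row22_inj[/eqP].
by rewrite mxE scale1r (negPf (pt_neq0 p)).
Qed.

Lemma trans_not_graph p a o M :
  ~~ (transversal (pt p) a (pt o) <= graph_line M)%MS.
Proof.
apply/negP=> /(submx_vec (row2 0 1))[y'].
rewrite mul_transversal mul_graph_line => /row22_inj[<-].
rewrite !mxE /= !scale0r mul0mx add0r scale1r => /mulK_eq0/(_ (pt_neq0 p)).
by move/eqP; rewrite (negPf (pt_neq0 o)).
Qed.

Lemma trans_inj p o t p' o' t' :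
  (transversal (pt p) (off o t) (pt o) <=
   transversal (pt p') (off o' t') (pt o'))%MS -> (o, t) = (o', t').
Proof.
move=> s; have [y] := submx_vec (row2 0 1) s; have [z] := submx_vec (row2 1 0) s.
rewrite !mul_transversal !mxE /= !scale0r !scale1r add0r addr0.
case/row22_inj=> ep ea /row22_inj[e0 eb].
have {e0} y0 : y 0 0 = 0.
  move/esym/eqP: e0; rewrite scaler_eq0 (negPf (pt_neq0 p')) orbF.
  by move/eqP.
have z0 : z 0 0 != 0.
  by apply: contraTneq (pt_neq0 p) => z0; rewrite ep z0 scale0r eqxx.
have {}eb : z 0 0 *: pt o = y 0 1 *: pt o'.
  move: eb; rewrite y0 scale0r add0r ep -scalemxAl scalemxAr -linearZ => /eqP.
  rewrite -subr_eq0 -mulmxBr -linearB => /eqP/mulK_eq0/(_ (pt_neq0 p'))/eqP.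
  by rewrite subr_eq0 => /eqP.
have eo : o = o'.
  by apply/eqP; apply: contraNT z0 => neq; case: (pt_indep neq eb) => /eqP.
case: _ / eo ea {eb s} => ea; congr (_, _).
apply: (@off_inj o t t' ((z 0 0)^-1 * z 0 1)).
move: ea; rewrite ep -scalemxAl scalemxAr -linearZ => /eqP.
rewrite -subr_eq0 -mulmxBr -linearB => /eqP/mulK_eq0/(_ (pt_neq0 p'))/eqP.
rewrite opprD addrA subr_eq0 -scalerBr -scalerA => /eqP <-.
by rewrite scalerA mulVf ?scale1r.
Qed.

Lemma shiftedE a b s u :
  shifted a b (row2 s u) =
  K (a + s *: b) + K (u *: b) *m K' (delta_mx 0 1).
Proof.
rewrite /shifted (_ : row2 s u = s *: delta_mx 0 0 + u *: delta_mx 0 1).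
  rewrite [K' _]linearD /= quad_mx_const mulmxDr mul_mx_scalar linearD addrA.
  by rewrite [K' _]linearZ -scalemxAr [K (u *: _)]linearZ -scalemxAl linearZ.
by apply: row2P; rewrite !mxE /= ?mulr1 ?mulr0 ?addr0 ?add0r.
Qed.

Lemma shifted_not_field o t s u r : u != 0 ->
  shifted (off o t) (pt o) (row2 s u) != K r.
Proof.
move=> u0; apply/eqP; rewrite shiftedE.
rewrite -[K r]addr0 -(mul0mx _ (K' (delta_mx 0 1))) -(linear0 K).
case/(quad_mx_direct v_irr c_neq0 c_neq1)=> _ /eqP.
by rewrite scaler_eq0 (negPf u0) (negPf (pt_neq0 _)).
Qed.

Lemma shifted_inj o t s u o' t' s' u' : u != 0 ->
  shifted (off o t) (pt o) (row2 s u) = shifted (off o' t') (pt o') (row2 s' u') ->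
  (o, t) = (o', t').
Proof.
move=> u0; rewrite !shiftedE => /(quad_mx_direct v_irr c_neq0 c_neq1)[ea eb].
have eo : o = o'.
  by apply/eqP; apply: contraNT u0 => neq; case: (pt_indep neq eb) => /eqP.
case: _ / eo ea {eb} => /eqP; rewrite -subr_eq0 opprD addrACA -scalerBl => e.
congr (_, _); apply: (@off_inj o t t' (s' - s)).
by apply/eqP; rewrite -subr_eq0 -scaleNr opprB.
Qed.

Lemma packing_line_packing : line_packing packing_line.
Proof.
split; [exact: packing_line_free | exact: packing_line_disjoint |].
move=> cl cl' i i' neq; apply/negP=> le1.
have le2 := row_free_submx_sym (packing_line_free _ _) (packing_line_free _ _) le1.
move: le1 le2 neq.
case: (packing_lineP cl i) => [e|s u e|o t p e|o t s u e u0];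
case: (packing_lineP cl' i') => [e'|s' u' e'|o' t' p' e'|o' t' s' u' e' u0'];
  rewrite e e'; do ?[by rewrite eqxx | by rewrite (negPf (graph_not_infinity _))
    | by rewrite (negPf (trans_not_infinity _ _ _))
    | by rewrite (negPf (trans_not_graph _ _ _ _))].
- by move=> /graph_line_inj/esym/eqP; rewrite (negPf (shifted_not_field _ _ _ _ u0')).
- by move=> /trans_inj ->; rewrite eqxx.
- by move=> /graph_line_inj/eqP; rewrite (negPf (shifted_not_field _ _ _ _ u0)).
- by move=> /graph_line_inj/(shifted_inj u0) ->; rewrite eqxx.
Qed.

End Packing.

(** * A packing of the lines of PG(3, 2) *)

Section BinaryPacking.

(** A packing of the lines of PG(3, 2).  Each pair spans a line, where a vector is
    encoded by the integer with the corresponding binary digits.  The seven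
    classes are the images of the first one under a Singer cycle of the plane
    spanned by the vectors 1, 2 and 4, which fixes the vector 8. *)
Definition binary_table : seq (seq (nat * nat)) :=
  [:: [:: (1, 2); (5, 8); (6, 15); (4, 14); (7, 12)];
      [:: (2, 4); (1, 8); (7, 13); (3, 15); (5, 11)];
      [:: (4, 3); (2, 8); (5, 9); (6, 13); (1, 14)];
      [:: (3, 6); (4, 8); (1, 10); (7, 9); (2, 15)];
      [:: (6, 7); (3, 8); (2, 12); (5, 10); (4, 13)];
      [:: (7, 5); (6, 8); (4, 11); (1, 12); (3, 9)];
      [:: (5, 1); (7, 8); (3, 14); (2, 11); (6, 10)]].

Definition binary_line (c i : nat) : nat * nat :=
  nth (0, 0) (nth [::] binary_table c) i.

Definition bit (n j : nat) : bool := odd (n %/ 2 ^ j).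

(** The digit of index [j] of [a l.1 + b l.2] over the field with two elements. *)
Definition bit_comb (a b : bool) (l : nat * nat) (j : nat) : bool :=
  (a && bit l.1 j) (+) (b && bit l.2 j).

Definition same_comb (a b : bool) (l : nat * nat) (a' b' : bool) l' : bool :=
  all (fun j => bit_comb a b l j == bit_comb a' b' l' j) (iota 0 4).

Definition allb (P : pred bool) : bool := P true && P false.

Lemma allbP (P : pred bool) : allb P -> forall b, P b.
Proof. by case/andP=> ? ? []. Qed.

Lemma binary_disjoint_check : all (fun c => all (fun i => all (fun i' =>
  (i != i') ==> allb (fun a => allb (fun b => allb (fun a' => allb (fun b' =>
    same_comb a b (binary_line c i) a' b' (binary_line c i') ==> ~~ a && ~~ b)))))
  (iota 0 5)) (iota 0 5)) (iota 0 7).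
Proof. by vm_compute. Qed.

Lemma binary_distinct_check : all (fun c => all (fun c' => all (fun i =>
  all (fun i' => (c != c') ==> ~~ allb (fun a => allb (fun b =>
    ~~ allb (fun a' => allb (fun b' =>
      ~~ same_comb a b (binary_line c i) a' b' (binary_line c' i'))))))
  (iota 0 5)) (iota 0 5)) (iota 0 7)) (iota 0 7).
Proof. by vm_compute. Qed.

Local Open Scope ring_scope.
Variable F : finFieldType.
Hypothesis card2 : #|F| = 2%N.

Lemma card2_val (x : F) : x = (x != 0)%:R.
Proof.
have [-> // | x0] := eqVneq x 0; apply/eqP; apply/negPn/negP=> /= x1.
have : (#|[:: 0%R; 1%R; x]| <= #|F|)%N by apply: max_card.
rewrite card2; have /card_uniqP-> // : uniq [:: 0; 1; x].
by rewrite /= !inE negb_or ![_ == x]eq_sym x0 x1 eq_sym oner_eq0.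
Qed.

Lemma card2_addb (a b : bool) : a%:R + b%:R = (a (+) b)%:R :> F.
Proof.
case: a b => [] []; rewrite ?addr0 ?add0r //=.
rewrite [RHS]/=; rewrite [LHS]card2_val; case: eqP => // /eqP h.
have /eqP := card2_val (1 + 1 : F); rewrite h -subr_eq0 addrK.
by rewrite oner_eq0.
Qed.

Lemma card2_inj (a b : bool) : a%:R = b%:R :> F -> a = b.
Proof. by case: a b => [] [] //= /eqP; rewrite ?oner_eq0 // eq_sym oner_eq0. Qed.

Definition binary_mx (c : 'I_7) (i : 'I_5) : 'M[F]_(2, 4) :=
  \matrix_(k, j) (bit (if k == 0 then (binary_line c i).1
                       else (binary_line c i).2) j)%:R.

Definition brow (a b : bool) : 'rV[F]_2 := row2 a%:R b%:R.

Lemma brow_surj (x : 'rV[F]_2) : x = brow (x 0 0 != 0) (x 0 1 != 0).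
Proof. by apply: row2P; rewrite mxE -?card2_val. Qed.

Lemma mul_binary_mx a b c i j :
  (brow a b *m binary_mx c i) 0 j = (bit_comb a b (binary_line c i) j)%:R.
Proof. by rewrite mulmx2E !mxE /= -!natrM !mulnb card2_addb. Qed.

Lemma mul_binary_mx_eq a b (c : 'I_7) (i : 'I_5) a' b' (c' : 'I_7) (i' : 'I_5) :
  brow a b *m binary_mx c i = brow a' b' *m binary_mx c' i' ->
  same_comb a b (binary_line c i) a' b' (binary_line c' i').
Proof.
move/rowP=> e; apply/allP=> j; rewrite mem_iota => /= lj; apply/eqP.
by apply: card2_inj; have := e (Ordinal lj); rewrite !mul_binary_mx.
Qed.

Lemma binary_packing : line_packing binary_mx.
Proof.
have dis c i i' (x y : 'rV[F]_2) : i != i' -> x *m binary_mx c i = y *m binary_mx c i' -> x = 0.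
  rewrite (brow_surj x) (brow_surj y) => neq /mul_binary_mx_eq.
  move: (x 0 0 != 0) (x 0 1 != 0) (y 0 0 != 0) (y 0 1 != 0) => a b a' b' e.
  have /allP/(_ c) := binary_disjoint_check; rewrite mem_iota ltn_ord => /(_ isT).
  move=> /allP/(_ i); rewrite mem_iota ltn_ord => /(_ isT).
  move=> /allP/(_ i'); rewrite mem_iota ltn_ord => /(_ isT).
  move/implyP/(_ neq)/allbP/(_ a)/allbP/(_ b)/allbP/(_ a')/allbP/(_ b').
  rewrite e => /andP[/negPf-> /negPf->].
  by apply: row2P; rewrite !mxE.
split=> //.
  move=> c i; apply: row_free_vec => x e.
  have [i' neq] : exists i', i != i'.
    by exists (if i == 0 then 1 else 0); case: (eqVneq i 0) => [->|].
  by apply: (dis c i i' x 0 neq); rewrite e mul0mx.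
move=> c c' i i' neq; apply/negP=> sub.
have /allP/(_ c) := binary_distinct_check; rewrite mem_iota ltn_ord => /(_ isT).
move=> /allP/(_ c'); rewrite mem_iota ltn_ord => /(_ isT).
move=> /allP/(_ i); rewrite mem_iota ltn_ord => /(_ isT).
move=> /allP/(_ i'); rewrite mem_iota ltn_ord => /(_ isT).
move/implyP/(_ neq)/negP; apply.
suff all_ab a b : ~~ allb (fun a' => allb (fun b' =>
    ~~ same_comb a b (binary_line c i) a' b' (binary_line c' i'))).
  by rewrite /allb !all_ab.
apply/negP=> h; have [y] := submx_vec (brow a b) sub.
rewrite (brow_surj y) => /mul_binary_mx_eq; apply/negP.
exact: (allbP (allbP h _)).
Qed.
End BinaryPacking.

(** * Existence of line packings *)

Section PackingExistence.
Local Open Scope ring_scope.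
Variable F : finFieldType.

Lemma exists_irreducible_quadratic : exists v : F, forall x, x ^+ 2 - x != v.
Proof.
apply: (@not_surj_of_collision _ (fun x : F => x ^+ 2 - x) 0 1).
  by rewrite eq_sym oner_neq0.
by rewrite expr0n subr0 expr1n subrr.
Qed.

(** For [q = 2] a separate packing is needed: there the only field of 2 x 2
    matrices with four elements that contains F is [K] itself. *)
Lemma exists_line_packing (q := #|F|) :
  exists (Cl Ix : finType) (L : Cl -> Ix -> 'M[F]_(2, 4)),
    [/\ line_packing L, #|Cl| = (q ^ 2 + q + 1)%N & #|Ix| = (q ^ 2 + 1)%N].
Proof.
have [q2 | q2] := eqVneq q 2%N.
  exists 'I_7, 'I_5, (@binary_mx F); split; last 2 first.
  - by rewrite card_ord q2.
  - by rewrite card_ord q2.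
  exact: binary_packing.
have [v v_irr] := exists_irreducible_quadratic.
have [c /andP[c0 c1]] : exists c : F, (c != 0) && (c != 1).
  apply/existsP; apply: contraNT q2; rewrite negb_exists => /forallP all01.
  suff eF : [set: F] = [set 0; 1].
    by rewrite /q -cardsT eF cards2 [0 == 1]eq_sym oner_eq0.
  apply/setP=> x; rewrite !inE; apply/esym; have := all01 x.
  by rewrite negb_and !negbK.
exists (option (option F * F)%type), (option (F * F)%type), (packing_line v c).
split; first exact: packing_line_packing.
  by rewrite card_option card_prod card_option mulSn mulnn addn1 addnC.
by rewrite card_option card_prod mulnn addn1.
Qed.
End PackingExistence.

(** * Optimal rank-metric codes with minimum distance 2 *)

Section RankCodes.
Local Open Scope ring_scope.
Variable F : finFieldType.

(** A set of matrices with minimum rank distance at least [d]. *)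
Definition rank_code (m n d : nat) (R : {set 'M[F]_(m, n)}) :=
  forall M M', M \in R -> M' \in R -> M != M' -> (d <= \rank (M - M')%R)%N.

Lemma exists_rank_code_2x2 :
  exists2 R : {set 'M[F]_2}, rank_code 2 R & #|R| = (#|F| ^ 2)%N.
Proof.
have [v v_irr] := exists_irreducible_quadratic F.
exists [set quad_mx v 1 p | p : 'rV[F]_2].
  move=> _ _ /imsetP[p _ ->] /imsetP[r _ ->] neq.
  rewrite -linearB mxrank_unit // quad_mx_unit ?oner_neq0 // subr_eq0.
  by apply: contra_neq neq => ->.
by rewrite card_imset ?card_mx ?mul1n //; apply: quad_mx_inj.
Qed.

(** The field with [q^4] elements as a 4-dimensional space of 4 x 4 matrices.  It
    is the quadratic extension [K(y)] with [y^2 = y + w], where [K = F[J]]; a root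
    of [t^2 + t = w] in [K] would be needed to make one of its nonzero elements
    singular. *)
Lemma exists_semifield_4 : exists E : 'I_4 -> 'M[F]_4,
  forall u : 'rV[F]_4, u != 0 -> \sum_i u 0 i *: E i \in unitmx.
Proof.
have [v v_irr] := exists_irreducible_quadratic F.
pose K := quad_mx v 1.
have [w w_irr] : exists w, forall t : 'rV[F]_2, t *m K t + t != w.
  pose e0 : 'rV[F]_2 := delta_mx 0 0.
  apply: (@not_surj_of_collision _ (fun t => t *m K t + t) 0 (- e0)).
    rewrite eq_sym oppr_eq0; apply/eqP=> /rowP/(_ 0)/eqP.
    by rewrite !mxE oner_eq0.
  have -> : K (- e0) = (-1)%:M by rewrite -scaleN1r /K quad_mx_const.
  by rewrite mul0mx addr0 mul_mx_scalar scaleN1r opprK subrr.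
pose E (u : 'rV[F]_(2 + 2)) : 'M[F]_(2 + 2) :=
  block_mx (K (lsubmx u)) (K (rsubmx u))
           (K (rsubmx u) *m K w) (K (lsubmx u) + K (rsubmx u)).
have E_lin : linear E.
  have KP a p r : K (a *: p + r) = a *: K p + K r by apply: linearP.
  move=> a x y; rewrite /E scale_block_mx add_block_mx !linearP !KP.
  by rewrite mulmxDl -scalemxAl scalerDr addrACA.
pose EL := GRing.isLinear.Build F _ _ _ E E_lin.
pose LE : {linear 'rV[F]_(2 + 2) -> 'M[F]_(2 + 2)} := HB.pack E EL.
exists (fun i => E (delta_mx 0 i)) => u u0.
have -> : \sum_i u 0 i *: E (delta_mx 0 i) = E u.
  rewrite [in RHS](row_sum_delta u) -[E]/(LE : _ -> _) linear_sum.
  by apply: eq_bigr => i _; rewrite linearZ.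
have Kunit p : p != 0 -> K p \in unitmx by apply: quad_mx_unit; rewrite ?oner_neq0.
have K0 (x p : 'rV_2) : x *m K p = 0 -> p != 0 -> x = 0.
  by move=> e /Kunit un; rewrite -[x](mulmxK un) e mul0mx.
rewrite -row_free_unit; apply: row_free_vec => x.
have -> : x = row_mx (lsubmx (x : 'rV_(2 + 2))) (rsubmx (x : 'rV_(2 + 2))).
  by rewrite hsubmxK.
move: (lsubmx _) (rsubmx _) => x1 x2.
pose p := lsubmx (u : 'rV_(2 + 2)); pose q := rsubmx (u : 'rV_(2 + 2)).
have -> : row_mx x1 x2 *m E u =
    row_mx (x1 *m K p + x2 *m (K q *m K w)) (x1 *m K q + x2 *m (K p + K q)).
  exact: mul_row_block.
move=> e; have [e1 e2] := row22_inj (etrans e (esym (row_mx0 F 1 2 2))).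
suff [-> ->] : x1 = 0 /\ x2 = 0 by rewrite row_mx0.
have [q0|q0] := eqVneq q 0.
  have p0 : p != 0.
    apply: contra_neq u0 => p0; transitivity (row_mx p q); first by rewrite hsubmxK.
    by rewrite p0 q0 row_mx0.
  have K00 : K 0 = 0 by apply: linear0.
  move: e1 e2; rewrite q0 K00 mul0mx !mulmx0 add0r !addr0.
  by move=> /K0/(_ p0)-> /K0/(_ p0)->.
have [r er] : exists r, invmx (K q) = K r by apply: quad_mx_inv.
have KM a b : K a *m K b = K (a *m K b) by apply: quad_mxM; rewrite oner_neq0.
have qr : K q *m K r = 1%:M by rewrite -er mulmxV ?Kunit.
pose t := p *m K r; have eKt : K t = K p *m K r by rewrite KM.
have ex1 : x1 = - (x2 *m (K t + 1%:M)).
  move/(congr1 (mulmx^~ (K r))): e2; rewrite mul0mx mulmxDl -mulmxA qr mulmx1.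
  by move/eqP; rewrite addr_eq0 -mulmxA mulmxDl qr -eKt => /eqP.
have x20 : x2 = 0.
  apply: (K0 _ (t *m K t + t - w)); last by rewrite subr_eq0.
  have -> : K (t *m K t + t - w) = K t *m K t + K t - K w.
    by rewrite KM [LHS]linearB [X in X - _]linearD.
  move/(congr1 (mulmx^~ (K r))): e1; rewrite mul0mx ex1 mulmxDl -!mulmxA mulNmx.
  rewrite -eKt -!mulmxA (quad_mxC v w r) [K q *m (_ *m _)]mulmxA qr mul1mx.
  move/eqP; rewrite addrC subr_eq0 mulmxDl mul1mx => /eqP ew.
  by rewrite mulmxBr ew subrr.
by split; rewrite // ex1 x20 mul0mx oppr0.
Qed.

(** The code of all [M] whose rows [M_i] satisfy [sum_i M_i E_i = 0].  A matrix
    [c r] of rank one does not belong to it, since [r (sum_i c_i E_i)] is nonzero;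
    three of the rows can be chosen freely. *)
Lemma exists_rank_code_4x4 :
  exists2 R : {set 'M[F]_4}, rank_code 2 R & #|R| = (#|F| ^ 12)%N.
Proof.
have [E E_unit] := exists_semifield_4.
pose syn (M : 'M[F]_4) := \sum_i row i M *m E i.
have E00 : E 0 \in unitmx.
  have := E_unit (delta_mx 0 0); rewrite (bigD1 0) //= big1 ?addr0.
    rewrite mxE scale1r; apply.
    by apply/eqP=> /rowP/(_ 0)/eqP; rewrite !mxE oner_eq0.
  by move=> i; rewrite mxE => /negPf->; rewrite andbF scale0r.
pose r0 (Z : 'M[F]_(3, 4)) :=
  - (\sum_k row k Z *m E (lift 0 k)) *m invmx (E 0).
pose ext (Z : 'M[F]_(3, 4)) : 'M[F]_4 :=
  \matrix_i (if unlift 0 i is Some k then row k Z else r0 Z).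
have ext_inj : injective ext.
  move=> Z Z' e; apply/row_matrixP=> k.
  by have := congr1 (row (lift 0 k)) e; rewrite !rowK liftK.
have syn_ext Z : syn (ext Z) = 0.
  rewrite /syn big_ord_recl rowK unlift_none mulmxKV //.
  rewrite [X in _ + X](eq_bigr (fun k => row k Z *m E (lift 0 k))) ?addNr // => k _.
  by rewrite rowK liftK.
exists [set ext Z | Z : 'M[F]_(3, 4)]; last by rewrite card_imset ?card_mx.
move=> _ _ /imsetP[Z _ ->] /imsetP[Z' _ ->] neq; rewrite ltnNge.
have : syn (ext Z - ext Z') = 0.
  rewrite -[RHS](subrr 0) -{1}(syn_ext Z) -(syn_ext Z') -sumrB.
  by apply: eq_bigr => i _; rewrite linearB mulmxBl.
have : ext Z - ext Z' != 0 by rewrite subr_eq0.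
move: (ext Z - ext Z') => {neq} D D0 sD; apply/negP=> rD.
have r1 : \rank D = 1%N by apply/eqP; rewrite eqn_leq rD lt0n mxrank_eq0.
have := mulmx_base D; move: (col_base D) (row_base D); rewrite r1 => c r eD.
have E0 : r *m (\sum_i c^T 0 i *: E i) = 0.
  rewrite -sD /syn mulmx_sumr; apply: eq_bigr => i _.
  rewrite -eD row_mul [row i c]mx11_scalar mul_scalar_mx !mxE -scalemxAl.
  by rewrite scalemxAr.
have c0 : c^T != 0.
  apply: contra_neq D0 => c0.
  by rewrite -eD -[c]trmxK c0 trmx0 mul0mx.
by case/eqP: D0; rewrite -eD -[r](mulmxK (E_unit _ c0)) E0 mul0mx mulmx0.
Qed.
End RankCodes.

(** * Subspace codes and filtrations *)

Section CodeSize.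
Variables (F : finFieldType) (n k e : nat) (I : finType).

(** For subspaces of dimension [k], a distance of at least [2 e] means an
    intersection of dimension at most [k - e]. *)
Lemma max_code_size_ge (D : {set I}) (U : I -> {vspace 'rV[F]_n}) : 0 < e ->
  {in D, forall w, \dim (U w) = k} ->
  {in D &, forall w w', w != w' -> \dim (U w :&: U w') + e <= k} ->
  #|D| <= max_code_size F n e.*2 k.
Proof.
move=> e0 dimU capU.
have U_inj : {in D &, injective U}.
  move=> w w' wD w'D eU; apply/eqP/negPn/negP => /(capU _ _ wD w'D).
  by rewrite -eU capvv dimU //; lia.
rewrite -(card_in_imset U_inj) /max_code_size.
apply: (leq_bigmax_cond (P := fun C => is_constant_dim_code e.*2 k C)).
apply/andP; split.
  by apply/forall_inP=> _ /imsetP[w wD ->]; rewrite dimU.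
apply/forall_inP=> _ /imsetP[w wD ->]; apply/forall_inP=> _ /imsetP[w' w'D ->].
apply/implyP=> neq; rewrite /subspace_dist.
have {}neq : w != w' by apply: contra_neq neq => ->.
have := dimv_sum_cap (U w) (U w'); rewrite !dimU //.
have := capU _ _ wD w'D neq; lia.
Qed.
End CodeSize.

Section Filtration.
Local Open Scope ring_scope.
Variables (F : fieldType) (V Y : vectType F) (m : nat).
Variable blk : 'I_m.+1 -> 'Hom(V, Y).
Hypothesis blk_inj : forall v, (forall k, blk k v = 0) -> v = 0.

(** The coordinate projections [blk k] filter [W] by the subspaces on which the
    first [k] of them vanish; [Gam k] contains the [k]-th graded piece. *)
Lemma filtration_dim (W : {vspace V}) (Gam : 'I_m.+1 -> {vspace Y}) :
  (forall (k : 'I_m.+1) v, v \in W -> (forall j : 'I_m.+1, (j < k)%N -> blk j v = 0) ->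
     blk k v \in Gam k) ->
  (\dim W <= \sum_k \dim (Gam k))%N.
Proof.
move=> grW.
pose fix tail n :=
  if n is n'.+1 then (tail n' :&: lker (blk (inord n')))%VS else W.
have mem_tail n v : (n <= m.+1)%N -> v \in tail n ->
    v \in W /\ forall j : 'I_m.+1, (j < n)%N -> blk j v = 0.
  elim: n => [|n IH] //= ltn; rewrite memv_cap memv_ker => /andP[vt /eqP vn].
  have [vW vlt] := IH (ltnW ltn) vt; split=> // j.
  rewrite ltnS leq_eqVlt => /predU1P[ej|]; last exact: vlt.
  by rewrite -vn -ej inord_val.
have dim_tail n : (n <= m.+1)%N ->
    (\dim W <= \sum_(0 <= k < n) \dim (Gam (inord k)) + \dim (tail n))%N.
  elim: n => [|n IH] ltn; first by rewrite big_geq.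
  apply: leq_trans (IH (ltnW ltn)) _; rewrite big_nat_recr //= -addnA leq_add2l.
  rewrite -(limg_ker_dim (blk (inord n)) (tail n)) addnC leq_add2r dimvS //.
  apply/subvP=> _ /memv_imgP[v vt ->].
  have [vW vlt] := mem_tail _ _ (ltnW ltn) vt; apply: grW => // j.
  by rewrite inordK //; apply: vlt.
have tail0 : tail m.+1 = 0%VS.
  apply/eqP; rewrite -subv0; apply/subvP=> v /(mem_tail _ _ (leqnn _))[_ v0].
  by rewrite memv0; apply/eqP/blk_inj => j; apply: v0.
have := dim_tail _ (leqnn _); rewrite tail0 dimv0 addn0 big_mkord.
by rewrite (eq_bigr (fun k => \dim (Gam k))) // => k _; rewrite inord_val.
Qed.
End Filtration.

Section Subspaces.
Local Open Scope ring_scope.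
Variable F : finFieldType.

Lemma dim_limg_le (aT rT : vectType F) (f : 'Hom(aT, rT)) :
  (\dim (limg f) <= dim aT)%N.
Proof. by rewrite -dimvf -(limg_ker_dim f fullv) leq_addl. Qed.

Definition row_space m n (A : 'M[F]_(m, n)) : {vspace 'rV[F]_n} :=
  limg (linfun (mulmxr A : 'rV_m -> 'rV_n)).

Lemma mem_row_space m n (A : 'M[F]_(m, n)) x : x *m A \in row_space A.
Proof.
by apply/memv_imgP; exists x; rewrite ?memvf // lfunE.
Qed.

Lemma row_spaceP m n (A : 'M[F]_(m, n)) v :
  v \in row_space A -> exists x, v = x *m A.
Proof. by case/memv_imgP=> x _ ->; exists x; rewrite lfunE. Qed.

Lemma dim_rowvec n : dim 'rV[F]_n = n.
Proof. exact: mul1n. Qed.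

Lemma dim_row_space_le m n (A : 'M[F]_(m, n)) : (\dim (row_space A) <= m)%N.
Proof. by rewrite -[leqRHS]dim_rowvec dim_limg_le. Qed.

Lemma dim_cap_lines n (A B : 'M[F]_(2, n)) :
  ~~ (A <= B)%MS -> (\dim (row_space A :&: row_space B) <= 1)%N.
Proof.
move=> nAB; rewrite leqNgt; apply: contra nAB => dAB.
have /eqP eA : (row_space A :&: row_space B)%VS == row_space A.
  by rewrite eqEdim capvSl (leq_trans (dim_row_space_le A)).
apply/row_subP=> j; rewrite rowE.
have: delta_mx 0 j *m A \in row_space B.
  by have := mem_row_space A (delta_mx 0 j); rewrite -{1}eA memv_cap => /andP[].
by case/row_spaceP=> y ->; apply: submxMl.
Qed.

Lemma dim_cap_disjoint m n (A B : 'M[F]_(m, n)) :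
  (forall x y : 'rV_m, x *m A = y *m B -> x = 0) ->
  \dim (row_space A :&: row_space B) = 0%N.
Proof.
move=> dis; apply/eqP; rewrite dimv_eq0 -subv0; apply/subvP=> v.
rewrite memv_cap memv0 => /andP[/row_spaceP[x ->] /row_spaceP[y /dis ->]].
by rewrite mul0mx.
Qed.

(** The vector [(x G_0, x G_1, x G_2, x G_3)] of F^16. *)
Definition word (G : 'I_4 -> 'M[F]_4) (x : 'rV[F]_4) : 'rV[F]_(4 * 4) :=
  mxvec (\matrix_k (x *m G k)).

Fact word_linear G : linear (word G).
Proof.
move=> a x y; rewrite /word -linearP; congr mxvec; apply/row_matrixP=> k.
by rewrite linearP /= !rowK mulmxDl scalemxAl.
Qed.
HB.instance Definition _ G :=
  GRing.isLinear.Build F 'rV[F]_4 'rV[F]_(4 * 4) _ (word G) (word_linear G).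

(** The projection of F^16 onto its [k]-th factor F^4. *)
Definition block (k : 'I_4) : 'Hom('rV[F]_(4 * 4), 'rV[F]_4) :=
  linfun (row k \o vec_mx).

Lemma block_word G k x : block k (word G x) = x *m G k.
Proof. by rewrite lfunE /= mxvecK rowK. Qed.

Lemma block_inj v : (forall k, block k v = 0) -> v = 0.
Proof.
move=> v0; rewrite -[v]vec_mxK; apply/eqP; rewrite mxvec_eq0; apply/eqP.
by apply/row_matrixP=> k; have := v0 k; rewrite lfunE /= row0.
Qed.

(** The row space of the 4 x 16 matrix [(G_0, G_1, G_2, G_3)]. *)
Definition code_space G : {vspace 'rV[F]_(4 * 4)} := limg (linfun (word G)).

Lemma code_spaceP G v : v \in code_space G -> exists x, v = word G x.
Proof. by case/memv_imgP=> x _ ->; exists x; rewrite lfunE. Qed.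

Lemma dim_code_space G :
  (forall x : 'rV_4, (forall k, x *m G k = 0) -> x = 0) -> \dim (code_space G) = 4%N.
Proof.
move=> inj; rewrite limg_dim_eq ?dimvf ?dim_rowvec //.
apply/eqP; rewrite -subv0; apply/subvP=> x; rewrite memv_cap memv_ker memv0 lfunE /=.
case/andP=> _ /eqP w0; apply/eqP/inj => k.
by rewrite -block_word w0 linear0.
Qed.

(** A subspace of a codeword all of whose coordinate vectors are killed by a matrix
    of rank at least 2 has dimension at most 4 - 2. *)
Lemma code_space_ker_dim G n (Q : 'M[F]_(4, n)) (W : {vspace 'rV[F]_(4 * 4)}) :
  (2 <= \rank Q)%N ->
  (forall v, v \in W -> exists2 x : 'rV_4, v = word G x & x *m Q = 0) ->
  (\dim W <= 2)%N.
Proof.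
move=> rQ kerW; pose B := row_base (kermx Q).
have sW : (W <= linfun (word G) @: row_space B)%VS.
  apply/subvP=> v /kerW[x -> xQ].
  have : (x <= B)%MS by rewrite eq_row_base; apply/sub_kermxP.
  case/submxP=> y ->; apply/memv_imgP; exists (y *m B); first exact: mem_row_space.
  by rewrite lfunE.
apply: leq_trans (dimvS sW) _; apply: leq_trans (_ : \dim (row_space B) <= _)%N.
  by rewrite -(limg_ker_dim (linfun (word G)) (row_space B)) leq_addl.
apply: leq_trans (dim_row_space_le B) _.
by rewrite mxrank_ker leq_subLR; apply: leq_trans (_ : 2 + 2 <= _)%N; rewrite ?leq_add2r.
Qed.
End Subspaces.

(** * The code *)

Section Construction.
Local Open Scope ring_scope.
Variables (F : finFieldType) (Cl Ix : finType) (L : Cl -> Ix -> 'M[F]_(2, 4)).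
Hypothesis L_packing : line_packing L.
(* The line [L c (other b)] serves as a complement of [L c b]. *)
Variable other : Ix -> Ix.
Hypothesis other_neq : forall i, i != other i.
Variables (R2 : {set 'M[F]_2}) (R4 : {set 'M[F]_4}).
Hypotheses (R2_code : rank_code 2 R2) (R4_code : rank_code 2 R4).

(** The types of codewords: [inl i] for the subspaces with four pivots in the
    factor [i], and [inr ((i, j), (c, a, b))] with [i < j] for those with two
    pivots in each of the factors [i] and [j], with graded pieces [L c a] and
    [L c b] there. *)
Definition skeleton : predArgType :=
  ('I_4 + ('I_4 * 'I_4) * (Cl * Ix * Ix))%type.

(** The admissible [k]-th blocks of the generator matrices of a given type.  The
    pairs [i >= j] are discarded by giving them no admissible block at all. *)
Definition blocks (t : skeleton) (k : 'I_4) : {set 'M[F]_4} :=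
  match t with
  | inl i => if (k < i)%N then [set 0] else if k == i then [set 1%:M] else R4
  | inr ((i, j), (c, a, b)) =>
    if ~~ (i < j)%N then set0
    else if (k < i)%N then [set 0]
    else if k == i then [set (col_mx (L c a) 0 : 'M_(2 + 2, 4))]
    else if (k < j)%N then
      [set (col_mx (row_mx N.1 N.2) 0 : 'M_(2 + 2, 2 + 2)) | N in setX R2 R2]
    else if k == j then
      [set (col_mx (N *m L c (other b)) (L c b) : 'M_(2 + 2, 4)) | N in R2]
    else R4
  end.

(** The graded pieces of the codewords of a given type. *)
Definition graded (t : skeleton) (k : 'I_4) : {vspace 'rV[F]_4} :=
  match t with
  | inl i => if k == i then fullv else 0%VS
  | inr ((i, j), (c, a, b)) =>
    if k == i then row_space (L c a)
    else if k == j then row_space (L c b) else 0%VS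
  end.

(** The coordinates of a vector of F^4 on the upper and on the lower two rows of a
    generator matrix. *)
Definition lhalf (x : 'rV[F]_4) : 'rV[F]_2 := lsubmx (x : 'rV_(2 + 2)).
Definition rhalf (x : 'rV[F]_4) : 'rV[F]_2 := rsubmx (x : 'rV_(2 + 2)).

Lemma half_inj x y : lhalf x = lhalf y -> rhalf x = rhalf y -> x = y.
Proof.
move=> et eb; rewrite -[x](@hsubmxK _ 1 2 2) -[y](@hsubmxK _ 1 2 2).
by rewrite -/(lhalf x) -/(rhalf x) et eb.
Qed.

Lemma mul_vec_col (x : 'rV[F]_4) n (A B : 'M[F]_(2, n)) :
  x *m (col_mx A B : 'M_(2 + 2, n)) = lhalf x *m A + rhalf x *m B.
Proof.
transitivity (row_mx (lhalf x) (rhalf x) *m col_mx A B); first by rewrite hsubmxK.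
exact: mul_row_col.
Qed.

Lemma mul_vec_row (x : 'rV[F]_2) (A B : 'M[F]_2) :
  x *m (row_mx A B : 'M_(2, 4)) = row_mx (x *m A) (x *m B).
Proof. exact: (@mul_mx_row _ 1 2 2 2). Qed.

Lemma line_inj c a (x y : 'rV_2) : x *m L c a = y *m L c a -> x = y.
Proof. by case: L_packing => free _ _; apply: (row_free_inj (free c a)). Qed.

Lemma line_disjoint c a b (x y : 'rV_2) :
  a != b -> x *m L c a = y *m L c b -> x = 0.
Proof. by case: L_packing => _ dis _; apply: dis. Qed.

Lemma line_compl c b (x y x' y' : 'rV_2) :
  x *m L c (other b) + y *m L c b = x' *m L c (other b) + y' *m L c b ->
  x = x' /\ y = y'.
Proof.
move/eqP; rewrite -subr_eq0 opprD addrACA -!mulmxBl addr_eq0 -mulNmx => /eqP e.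
have /eqP : x - x' = 0 by apply: line_disjoint e; rewrite eq_sym.
rewrite subr_eq0 => /eqP ex; split=> //; move: e; rewrite ex subrr mul0mx.
rewrite -(mul0mx _ (L c b)) => /line_inj/eqP; rewrite eq_sym oppr_eq0 subr_eq0.
by move/eqP.
Qed.

Lemma R2_unit (N N' : 'M_2) (x : 'rV_2) :
  N \in R2 -> N' \in R2 -> N != N' -> x *m N = x *m N' -> x = 0.
Proof.
move=> NR N'R neq /eqP; rewrite -subr_eq0 -mulmxBr => /eqP e.
have u : N - N' \in unitmx.
  by rewrite -row_free_unit /row_free eqn_leq rank_leq_row R2_code.
by rewrite -[x](mulmxK u) e mul0mx.
Qed.

(** What the generator matrices with two pivots in each of two factors look like. *)
Lemma blocks_pairP t (G : 'I_4 -> 'M[F]_4) i j c a b :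
  t = inr ((i, j), (c, a, b)) -> (forall k, G k \in blocks t k) ->
  [/\ (i < j)%N,
      G i = (col_mx (L c a) 0 : 'M_(2 + 2, 4)),
      forall k : 'I_4, (i < k < j)%N -> exists2 N, N \in setX R2 R2 &
        G k = (col_mx (row_mx N.1 N.2) 0 : 'M_(2 + 2, 2 + 2)),
      exists2 N, N \in R2 &
        G j = (col_mx (N *m L c (other b)) (L c b) : 'M_(2 + 2, 4))
    & (forall k : 'I_4, (k < i)%N -> G k = 0) /\
      (forall k : 'I_4, (j < k)%N -> G k \in R4)].
Proof.
move=> -> /= GS; have ltij : (i < j)%N.
  by have := GS i; case: (i < j)%N => //; rewrite inE.
split=> //.
- by have := GS i; rewrite ltij ltnn eqxx inE => /eqP.
- move=> k /andP[ik kj]; have := GS k; rewrite ltij ltnNge ltnW //= kj.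
  by rewrite -val_eqE /= gtn_eqF // => /imsetP[N NR ->]; exists N.
- have := GS j; rewrite ltij ltnNge ltnW //= ltnn eqxx.
  by rewrite -val_eqE /= gtn_eqF // => /imsetP[N NR ->]; exists N.
- split=> k lt; have := GS k; rewrite ltij /=; first by rewrite lt inE => /eqP.
  have ik := ltn_trans ltij lt.
  by rewrite -!val_eqE /= ltnNge ltnW //= gtn_eqF // ltnNge ltnW //= gtn_eqF.
Qed.

Lemma blocks_singleP (G : 'I_4 -> 'M[F]_4) i :
  (forall k, G k \in blocks (inl i) k) ->
  [/\ G i = 1%:M, forall k : 'I_4, (k < i)%N -> G k = 0
    & forall k : 'I_4, (i < k)%N -> G k \in R4].
Proof.
move=> /= GS; split.
- by have := GS i; rewrite ltnn eqxx inE => /eqP.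
- by move=> k lt; have := GS k; rewrite lt inE => /eqP.
- move=> k lt; have := GS k.
  by rewrite -val_eqE /= ltnNge ltnW //= gtn_eqF.
Qed.

Lemma graded_mem t G (k : 'I_4) (x : 'rV_4) : (forall k, G k \in blocks t k) ->
  (forall j : 'I_4, (j < k)%N -> x *m G j = 0) -> x *m G k \in graded t k.
Proof.
case: t => [i|[[i j] [[c a] b]]].
  case/blocks_singleP=> Gi Glt _ x0 /=; have [_|neq] := eqVneq k i.
    exact: memvf.
  have [lt|lt|/val_inj e] := ltngtP k i; last by rewrite e eqxx in neq.
    by rewrite Glt // mulmx0 mem0v.
  by have := x0 i lt; rewrite Gi mulmx1 => ->; rewrite mul0mx mem0v.
case/(blocks_pairP (erefl _)) => ltij Gi Gmid [N NR Gj] [Glt Ggt] x0 /=.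
have topx : (i < k)%N -> lhalf x = 0.
  move=> lt; have := x0 i lt; rewrite Gi mul_vec_col mulmx0 addr0.
  by rewrite -(mul0mx _ (L c a)) => /line_inj.
have [ki|ik|/val_inj ->] := ltngtP k i; last 1 first.
- by rewrite eqxx Gi mul_vec_col mulmx0 addr0 mem_row_space.
- by rewrite Glt // mulmx0 mem0v.
rewrite -val_eqE /= gtn_eqF //; have {}topx := topx ik.
have [kj|jk|/val_inj ->] := ltngtP k j; last 1 first.
- by rewrite eqxx Gj mul_vec_col topx mul0mx add0r mem_row_space.
- have [N' _ ->] := Gmid k (introT andP (conj ik kj)).
  by rewrite mul_vec_col topx mul0mx mulmx0 add0r mem0v.
have := x0 j jk; rewrite Gj mul_vec_col topx mul0mx add0r.
rewrite -(mul0mx _ (L c b)) => /line_inj botx.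
rewrite (_ : x = 0) ?mul0mx ?mem0v //.
by apply: half_inj; rewrite ?topx ?botx /lhalf /rhalf linear0.
Qed.

Lemma word_inj t G (x : 'rV_4) : (forall k, G k \in blocks t k) ->
  (forall k, x *m G k = 0) -> x = 0.
Proof.
case: t => [i|[[i j] [[c a] b]]].
  by case/blocks_singleP=> Gi _ _ /(_ i); rewrite Gi mulmx1.
case/(blocks_pairP (erefl _)) => _ Gi _ [N NR Gj] _ x0.
have topx : lhalf x = 0.
  have := x0 i; rewrite Gi mul_vec_col mulmx0 addr0.
  by rewrite -(mul0mx _ (L c a)) => /line_inj.
have botx : rhalf x = 0.
  have := x0 j; rewrite Gj mul_vec_col topx mul0mx add0r.
  by rewrite -(mul0mx _ (L c b)) => /line_inj.
by apply: half_inj; rewrite ?topx ?botx /lhalf /rhalf linear0.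
Qed.

(** Let a common vector have coordinates [x] and [y].  For the type [inl i], the
    block at [i] gives [x = y].  For the type [inr ((i, j), _)], it gives that the
    left halves of [x] and [y] agree.  If the matrices differ in some block after
    [i] and up to [j], that left half is 0, leaving dimension at most 2; otherwise
    the block at [j] gives [x = y].  When [x = y], the matrices differ in a later
    block, and [x] is in the kernel of that difference, which has rank at least 2. *)
Lemma dim_cap_same t G G' : (forall k, G k \in blocks t k) ->
  (forall k, G' k \in blocks t k) -> (exists k, G k != G' k) ->
  (\dim (code_space G :&: code_space G') <= 2)%N.
Proof.
move=> GS G'S [k0 neq0].
have capP v : v \in (code_space G :&: code_space G')%VS ->
    exists x y, v = word G x /\ forall k, x *m G k = y *m G' k.
  rewrite memv_cap => /andP[/code_spaceP[x ->] /code_spaceP[y e]].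
  by exists x, y; split=> // k; rewrite -!block_word e.
have cap_eq k : G k \in R4 -> G' k \in R4 -> G k != G' k ->
    (forall x y : 'rV_4, (forall j, x *m G j = y *m G' j) -> x = y) ->
    (\dim (code_space G :&: code_space G') <= 2)%N.
  move=> GR G'R neq xy; apply: (code_space_ker_dim (G := G) (R4_code GR G'R neq)).
  move=> v /capP[x [y [-> e]]]; exists x => //.
  by rewrite mulmxBr e (xy _ _ e) subrr.
case: t GS G'S => [i|[[i j] [[c a] b]]] GS G'S.
  have [Gi Glt Ggt] := blocks_singleP GS; have [G'i G'lt G'gt] := blocks_singleP G'S.
  have lt : (i < k0)%N.
    have [//|lt|/val_inj e] := ltngtP i k0.
      by move: neq0; rewrite Glt // G'lt // eqxx.
    by move: neq0; rewrite -e Gi G'i eqxx.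
  apply: (cap_eq k0); rewrite ?Ggt ?G'gt // => x y /(_ i).
  by rewrite Gi G'i !mulmx1.
have [ltij Gi Gmid [N NR Gj] [Glt Ggt]] := blocks_pairP (erefl _) GS.
have [_ G'i G'mid [N' N'R G'j] [G'lt G'gt]] := blocks_pairP (erefl _) G'S.
have top_eq (x y : 'rV_4) : (forall k, x *m G k = y *m G' k) -> lhalf x = lhalf y.
  by move/(_ i); rewrite Gi G'i !mul_vec_col !mulmx0 !addr0 => /line_inj.
case: (pickP [pred k : 'I_4 | (i < k <= j)%N && (G k != G' k)]) => [k|all_eq].
  case/andP=> /andP[ik kj] neq.
  have top0 (x y : 'rV_4) : (forall k, x *m G k = y *m G' k) -> lhalf x = 0.
    move=> e; have ext := top_eq _ _ e.
    move: kj; rewrite leq_eqVlt => /predU1P[/val_inj ekj | kj].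
      have := e j; rewrite Gj G'j !mul_vec_col !mulmxA -ext => /line_compl[eN _].
      apply: R2_unit eN => //; apply: contra_neq neq => eN.
      by rewrite ekj Gj G'j eN.
    have := e k; have [P] := Gmid k (introT andP (conj ik kj)).
    have [P'] := G'mid k (introT andP (conj ik kj)).
    case: P P' => [P1 P2] [P1' P2']; rewrite !inE /= => /andP[R1' R2'] eG'.
    case/andP=> R1 R2_ eG.
    rewrite eG eG' !mul_vec_col !mulmx0 !addr0 !mul_vec_row -ext.
    case/row22_inj=> e1 e2.
    have [eP1|neq1] := eqVneq P1 P1'; last exact: R2_unit e1.
    apply: R2_unit e2 => //; apply: contra_neq neq => eP2.
    by rewrite eG eG' eP1 eP2.
  pose Q : 'M[F]_(2 + 2, 2) := col_mx 1%:M 0.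
  apply: (@code_space_ker_dim _ G _ Q).
    have : \rank (row_mx 1%:M 0 *m Q) = 2%N.
      by rewrite mul_row_col mul1mx mulmx0 addr0 mxrank1.
    by move=> {1}<-; apply: mxrankM_maxr.
  move=> v /capP[x [y [-> e]]]; exists x => //.
  by rewrite mul_vec_col mulmx1 mulmx0 addr0 (top0 _ _ e).
have xy (x y : 'rV_4) : (forall k, x *m G k = y *m G' k) -> x = y.
  move=> e; have ext := top_eq _ _ e; apply: half_inj => //.
  have := e j; have := all_eq j; rewrite /= ltij leqnn /= => /negbFE/eqP <-.
  by rewrite Gj !mul_vec_col ext => /addrI/line_inj.
have lt : (j < k0)%N.
  rewrite ltnNge; apply/negP=> k0j; have := all_eq k0; rewrite /= k0j neq0 !andbT.
  move/negbT; rewrite -leqNgt leq_eqVlt => /predU1P[/val_inj e|lt].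
    by move: neq0; rewrite e Gi G'i eqxx.
  by move: neq0; rewrite Glt // G'lt // eqxx.
by apply: (cap_eq k0); rewrite ?Ggt ?G'gt.
Qed.

Definition ordered (t : skeleton) :=
  if t is inr ((i, j), _) then (i < j)%N else true.

(** Two types with different pivots share at most two of them.  If the pivots
    agree, the pairs of lines differ: either both lines differ, or one of them is
    replaced by a disjoint line of the same class. *)
Lemma graded_cap t t' : ordered t -> ordered t' -> t != t' ->
  (\sum_k \dim (graded t k :&: graded t' k) <= 2)%N.
Proof.
have cap_le n (U W : {vspace 'rV[F]_4}) : (\dim W <= n)%N -> (\dim (U :&: W) <= n)%N.
  by apply: leq_trans; rewrite dimvS ?capvSr.
case: t t' => [i|[[i j] [[c a] b]]] [i'|[[i' j'] [[c' a'] b']]] /=.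
- move=> _ _ neq; rewrite big1 // => k _.
  have [->|_] := eqVneq k i; last by rewrite cap0v dimv0.
  have [e|_] := eqVneq i i'; last by rewrite capv0 dimv0.
  by case/eqP: neq; rewrite e.
- move=> _ _ _; rewrite (bigD1 i) //= big1 ?addn0 => [|k /negPf->].
    apply: cap_le; do 2?[case: ifP => _; rewrite ?dim_row_space_le //].
    by rewrite dimv0.
  by rewrite cap0v dimv0.
- move=> _ _ _; rewrite (bigD1 i') //= big1 ?addn0 => [|k /negPf->].
    rewrite capvC; apply: cap_le.
    do 2?[case: ifP => _; rewrite ?dim_row_space_le //].
    by rewrite dimv0.
  by rewrite capv0 dimv0.
move=> ltij ltij' neq.
have nij : j != i by rewrite -val_eqE gtn_eqF.
have nij' : j' != i' by rewrite -val_eqE gtn_eqF.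
rewrite (bigD1 i) //= (bigD1 j) //= big1 => [|k /andP[/negPf-> /negPf->]]; last first.
  by rewrite cap0v dimv0.
rewrite addn0 eqxx (negPf nij) eqxx.
have dimL c0 a0 (W : {vspace 'rV[F]_4}) : (\dim (row_space (L c0 a0) :&: W) <= 2)%N.
  by apply: leq_trans (dim_row_space_le (L c0 a0)); rewrite dimvS ?capvSl.
have [ei|ni] := boolP (i \in [:: i'; j']); last first.
  move: ni; rewrite !inE negb_or => /andP[/negPf-> /negPf->].
  by rewrite capv0 dimv0 add0n dimL.
have [ej|nj] := boolP (j \in [:: i'; j']); last first.
  move: nj; rewrite !inE negb_or => /andP[/negPf-> /negPf->].
  by rewrite capv0 dimv0 addn0 dimL.
have [eii ejj] : i = i' /\ j = j'.
  move: ei ej ltij ltij'; rewrite !inE.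
  case/orP=> /eqP-> /orP[] /eqP-> //; rewrite ?ltnn //.
  by move=> /ltn_trans lt /lt; rewrite ltnn.
case: _ / eii neq {ei ej ltij' nij'} => neq; case: _ / ejj neq => neq.
rewrite eqxx (negPf nij) eqxx.
case: L_packing => _ dis nsub.
have [ec|nc] := eqVneq c c'; last first.
  by apply: (@leq_add _ _ 1 1); rewrite dim_cap_lines ?nsub.
case: _ / ec neq => neq.
have [ea|na] := eqVneq a a'; last first.
  by rewrite (dim_cap_disjoint (fun x y => dis c a a' x y na)) add0n dimL.
have [eb|nb] := eqVneq b b'; last first.
  by rewrite addnC (dim_cap_disjoint (fun x y => dis c b b' x y nb)) add0n dimL.
by case/eqP: neq; rewrite ea eb.
Qed.

(** The code, indexed by a type and a generator matrix of that type. *)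
Definition construction : {set skeleton * {ffun 'I_4 -> 'M[F]_4}} :=
  [set w | w.2 \in family (blocks w.1)].

Lemma construction_size :
  (#|construction| <= max_code_size F 16 4 4)%N.
Proof.
pose U (w : skeleton * {ffun 'I_4 -> 'M[F]_4}) := code_space w.2.
have inC t (G : {ffun 'I_4 -> 'M[F]_4}) : (t, G) \in construction ->
  forall k, G k \in blocks t k by rewrite inE => /familyP.
have ordC t G : (forall k, G k \in blocks t k) -> ordered t.
  case: t => [//|[[i j] [[c a] b]]] GS; by case: (blocks_pairP (erefl _) GS).
apply: (@max_code_size_ge _ 16 4 2 _ construction U) => //.
  by move=> [t G] /inC GS; apply: dim_code_space => x; apply: word_inj GS.
move=> [t G] [t' G'] /inC GS /inC G'S neq; rewrite (leq_add2r 2 _ 2).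
have [et|nt] := eqVneq t t'.
  case: _ / et G'S neq => G'S neq; apply: dim_cap_same GS G'S _.
  apply/existsP; apply: contraNT neq; rewrite negb_exists => /forallP eG.
  by apply/eqP; congr (_, _); apply/ffunP=> k; apply/eqP; have := eG k; rewrite negbK.
apply: leq_trans (graded_cap (ordC _ _ GS) (ordC _ _ G'S) nt).
apply: (filtration_dim (blk := @block F)); first exact: block_inj.
move=> k v; rewrite memv_cap => /andP[/code_spaceP[x ev] /code_spaceP[y ev']] v0.
rewrite memv_cap; apply/andP; split.
  rewrite ev block_word; apply: graded_mem GS _ => j /v0.
  by rewrite ev block_word.
rewrite ev' block_word; apply: graded_mem G'S _ => j /v0.
by rewrite ev' block_word.
Qed.
End Construction.

(** * The number of codewords *)

Section Count.
Variables (F : finFieldType) (Cl Ix : finType) (L : Cl -> Ix -> 'M[F]_(2, 4)).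
Hypothesis L_packing : line_packing L.
Variable other : Ix -> Ix.
Variables (q : nat) (R2 : {set 'M[F]_2}) (R4 : {set 'M[F]_4}).
Hypotheses (card_R2 : #|R2| = q ^ 2) (card_R4 : #|R4| = q ^ 12).
Hypotheses (card_Cl : #|Cl| = q ^ 2 + q + 1) (card_Ix : #|Ix| = q ^ 2 + 1).

(** The number of admissible [k]-th blocks for the type [inr ((i, j), _)]. *)
Definition pair_weight (i j k : nat) : nat :=
  if ~~ (i < j) then 0 else if k <= i then 1 else if k < j then q ^ 4
  else if k == j then q ^ 2 else q ^ 12.

Lemma card_blocks_single (i k : 'I_4) :
  #|blocks L other R2 R4 (inl i) k| = if k <= i then 1 else q ^ 12.
Proof.
by rewrite /= -val_eqE; case: (ltngtP (val k) (val i)) => _; rewrite ?cards1.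
Qed.

Lemma card_blocks_pair (i j k : 'I_4) c a b :
  #|blocks L other R2 R4 (inr ((i, j), (c, a, b))) k| = pair_weight i j k.
Proof.
rewrite /pair_weight /=; case: ifP => _; first by rewrite cards0.
rewrite -!val_eqE /=; case: (ltngtP (val k) (val i)) => _; rewrite ?cards1 //.
case: ifP => _.
  rewrite card_imset ?cardsX ?card_R2 -?expnD // => N N'.
  case/(@eq_col_mx _ 2 2 4) => /row22_mx_inj.
  by case: N N' => [N1 N2] [N1' N2'] /= [-> ->].
case: ifP => // _; rewrite card_imset // => N N' /(@eq_col_mx _ 2 2 4)[e _].
by case: L_packing => free _ _; apply: (row_free_inj (free _ _)) e.
Qed.

Lemma card_construction :
  #|construction L other R2 R4| =
  \sum_(i < 4) \prod_(k < 4) (if k <= i then 1 else q ^ 12) +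
  (q ^ 2 + q + 1) * (q ^ 2 + 1) ^ 2 *
  \sum_(i < 4) \sum_(j < 4) \prod_(k < 4) pair_weight i j k.
Proof.
transitivity (\sum_t \prod_(k < 4) #|blocks L other R2 R4 t k|).
  rewrite -sum1_card (eq_bigl (fun w => w.2 \in family (blocks L other R2 R4 w.1)));
    last by move=> w; rewrite inE.
  rewrite -(pair_big_dep xpredT (fun t G => G \in family (blocks L other R2 R4 t))
    (fun _ _ => 1)) /=.
  apply: eq_bigr => t _; rewrite sum1_card card_family foldrE big_map big_enum.
  by [].
rewrite big_sumType /=; congr (_ + _).
  by apply: eq_bigr => i _; apply: eq_bigr => k _; rewrite card_blocks_single.
rewrite pair_bigA big_distrr /=.
transitivity (\sum_(ij : 'I_4 * 'I_4) \sum_(l : Cl * Ix * Ix)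
    \prod_(k < 4) pair_weight ij.1 ij.2 k).
  rewrite pair_bigA; apply: eq_bigr => -[[i j] [[c a] b]] _ /=.
  by apply: eq_bigr => k _; rewrite card_blocks_pair.
apply: eq_bigr => ij _.
by rewrite sum_nat_const !card_prod card_Cl card_Ix -[_ ^ 2 in RHS]mulnn !mulnA.
Qed.
End Count.

Lemma construction_weight (q : nat) :
  \sum_(i < 4) \prod_(k < 4) (if k <= i then 1 else q ^ 12) +
  (q ^ 2 + q + 1) * (q ^ 2 + 1) ^ 2 *
  \sum_(i < 4) \sum_(j < 4) \prod_(k < 4) pair_weight q i j k =
  q ^ 36 + q ^ 32 + q ^ 31 + 3 * q ^ 30 + 2 * q ^ 29 + 3 * q ^ 28 + q ^ 27
  + q ^ 26 + 2 * q ^ 24 + q ^ 23 + 3 * q ^ 22 + 2 * q ^ 21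
  + 4 * q ^ 20 + 2 * q ^ 19 + 4 * q ^ 18 + 2 * q ^ 17 + 4 * q ^ 16
  + 2 * q ^ 15 + 4 * q ^ 14 + 2 * q ^ 13 + 5 * q ^ 12 + 2 * q ^ 11
  + 4 * q ^ 10 + 2 * q ^ 9 + 4 * q ^ 8 + 2 * q ^ 7 + 4 * q ^ 6 + 2 * q ^ 5
  + 3 * q ^ 4 + q ^ 3 + q ^ 2 + 1.
Proof.
rewrite !big_ord_recl !big_ord0 /pair_weight /=.
ring.
Qed.

(* Any two fields with q elements are isomorphic, so F is "the" field F_q. *)
Theorem mainTheorem2 (q : nat) (F : finFieldType) :
  prime_power q -> #|F| = q ->
  q ^ 36 + q ^ 32 + q ^ 31 + 3 * q ^ 30 + 2 * q ^ 29 + 3 * q ^ 28 + q ^ 27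
  + q ^ 26 + 2 * q ^ 24 + q ^ 23 + 3 * q ^ 22 + 2 * q ^ 21
  + 4 * q ^ 20 + 2 * q ^ 19 + 4 * q ^ 18 + 2 * q ^ 17 + 4 * q ^ 16
  + 2 * q ^ 15 + 4 * q ^ 14 + 2 * q ^ 13 + 5 * q ^ 12 + 2 * q ^ 11
  + 4 * q ^ 10 + 2 * q ^ 9 + 4 * q ^ 8 + 2 * q ^ 7 + 4 * q ^ 6 + 2 * q ^ 5
  + 3 * q ^ 4 + q ^ 3 + q ^ 2 + 1
  <= max_code_size F 16 4 4.
Proof.
move=> _ card_F.
have [Cl [Ix [L [L_packing card_Cl card_Ix]]]] := exists_line_packing F.
have [R2 R2_code card_R2] := exists_rank_code_2x2 F.
have [R4 R4_code card_R4] := exists_rank_code_4x4 F.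
rewrite card_F in card_Cl card_Ix card_R2 card_R4.
pose other (i : Ix) := odflt i [pick j | i != j].
have other_neq i : i != other i.
  rewrite /other; case: pickP => //= eq_i.
  have q_gt0 : 0 < q by rewrite -card_F; apply/card_gt0P; exists 0%R.
  have : #|Ix| <= 1.
    rewrite -(card1 i); apply/subset_leq_card/subsetP => j _; rewrite inE eq_sym.
    by have := eq_i j => /negbFE.
  by rewrite card_Ix addn1 ltnS leqn0 expn_eq0 eqn0Ngt q_gt0.
rewrite -construction_weight.
rewrite -(card_construction L_packing other card_R2 card_R4 card_Cl card_Ix).
exact: construction_size.
Qed.
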